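(* Let $n\ge 2$ and let $\mathcal P = P_1P_3\cdots P_{4n-1}\subset\mathbb{R}^2\subset\mathbb{P}^2$ be a generic axis-aligned $2n$-gon. Let $T$ be the pentagram map. Then $T^{n-1}(\mathcal P)$ collapses to the center of mass of $\mathcal P$; that is, all vertices of $T^{n-1}(\mathcal P)$ are equal to the single point $$\mathscr C(\mathcal P)=\frac{1}{2n}\left(P_1+P_3+\cdots+P_{4n-1}\right).$$
   Context: $\mathbb{P}^2$ is the real projective plane, containing the affine plane $\mathbb{R}^2$. A polygon is a cyclically ordered sequence of points (its vertices). A $2n$-gon has vertices labelled $P_1,P_3,\dots,P_{4n-1}$ (odd indices modulo $4n$). It is axis-aligned if its vertices lie in $\mathbb{R}^2$ and its edges (lines through consecutive vertices) are alternately parallel to the $x$-axis and to the $y$-axis; thus with $P_1P_3$ parallel to the $x$-axis one has $P_1=(a_1,b_1)$, $P_3=(a_2,b_1)$, $P_5=(a_2,b_2)$, $P_7=(a_3,b_2)$, ..., $P_{4n-3}=(a_n,b_n)$, $P_{4n-1}=(a_1,b_n)$, so the space of such polygons is parametrized by $(a_1,\dots,a_n,b_1,\dots,b_n)\in\mathbb{R}^{2n}$. ''Generic'' means: for all polygons in some nonempty Zariski-open subset of this parameter space. The pentagram map $T$ sends a polygon with consecutive vertices $v_1,\dots,v_N$ in $\mathbb{P}^2$ (indices mod $N$) to the polygon whose vertices are, in cyclic order, the points $l_i\cap l_{i+1}$, where $l_i$ is the line through $v_i$ and $v_{i+2}$; it is well defined when $v_i\neq v_{i+2}$ and $l_i\neq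 l_{i+1}$ for all $i$. $T^{k}$ denotes the $k$-th iterate. The center of mass $\mathscr C(\mathcal P)$ of an axis-aligned polygon is the average of its vertices. *)

(* Defs.v *)
From mathcomp Require Import all_boot all_order all_algebra.
From mathcomp Require Import reals.
From mathcomp Require Import mpoly.

Set Implicit Arguments.
Unset Strict Implicit.
Unset Printing Implicit Defensive.

Import Order.TTheory GRing.Theory Num.Theory.
Local Open Scope ring_scope.

Definition zariski_open (R : realType) (m : nat) (U : 'rV[R]_m -> Prop) : Prop :=
  exists S : {mpoly R[m]} -> Prop,
    forall x, U x <-> exists2 p, S p & p.@[fun i => x 0 i] != 0.

Definition generically (R : realType) (m : nat) (Q : 'rV[R]_m -> Prop) : Prop :=
  exists U : 'rV[R]_m -> Prop,
    [/\ zariski_open U, exists x, U x & forall x, U x -> Q x].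

(* Points of P^2 are the lines through the origin of R^3, so that the line
   through two points is their sum and lines intersect by :&:. *)
Definition proj_point (R : realType) : Type :=
  {p : {vspace 'rV[R]_3} | \dim p == 1%N}.

Definition proj_line (R : realType) (p q : proj_point R) : {vspace 'rV[R]_3} :=
  (val p + val q)%VS.

(* (x, y) |-> [x : y : 1] *)
Definition homogeneous (R : realType) (u : 'rV[R]_2) : 'rV[R]_3 :=
  row_mx u (1%:M : 'M_1).

Lemma dim_homogeneous (R : realType) (u : 'rV[R]_2) :
  \dim <[homogeneous u]>%VS == 1%N.
Proof.
rewrite dim_vline eqb1; apply/eqP => /matrixP/(_ 0 (rshift 2 (0 : 'I_1)))/eqP.
by rewrite (row_mxEr u) !mxE eqxx oner_eq0.
Qed.

Definition affine_point (R : realType) (u : 'rV[R]_2) : proj_point R :=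
  exist _ <[homogeneous u]>%VS (dim_homogeneous u).

Section Pentagram.
Variables (R : realType) (N : nat).
Implicit Type v : {ffun 'I_N -> proj_point R}.

(* [ordS] is the successor modulo N. *)
Definition diagonal v (i : 'I_N) : {vspace 'rV[R]_3} :=
  proj_line (v i) (v (ordS (ordS i))).

Definition pentagram_defined v : bool :=
  [forall i, (v i != v (ordS (ordS i))) && (diagonal v i != diagonal v (ordS i))].

(* The default value of [insubd] is never used: see [pentagramP]. *)
Definition pentagram v : option {ffun 'I_N -> proj_point R} :=
  if pentagram_defined v
  then Some [ffun i => insubd (v i) (diagonal v i :&: diagonal v (ordS i))%VS]
  else None.

Definition pentagram_iter (k : nat) v : option {ffun 'I_N -> proj_point R} :=
  iter k (obind pentagram) (Some v).

Lemma dim_proj_line (p q : proj_point R) : p != q -> \dim (proj_line p q) = 2%N.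
Proof.
case: p q => [p p1] [q q1]; rewrite -val_eqE /proj_line /= => pq.
have := dimv_sum_cap p q; rewrite (eqP p1) (eqP q1).
suff -> : \dim (p :&: q) = 0%N by rewrite addn0.
apply/eqP; rewrite -leqn0 -ltnS -[X in (_ < X)%N](eqP p1) ltn_neqAle dimvS ?capvSl // andbT.
apply: contra pq => capE; have cp : (p :&: q)%VS = p.
  by apply/eqP; rewrite eqEdim capvSl (eqP capE) leqnn.
by rewrite eqEdim (eqP p1) (eqP q1) leqnn andbT -cp capvSr.
Qed.

Lemma dim_meet (l m : {vspace 'rV[R]_3}) :
  \dim l = 2%N -> \dim m = 2%N -> l != m -> \dim (l :&: m) = 1%N.
Proof.
move=> l2 m2 lm; have := dimv_sum_cap l m; rewrite l2 m2.
have le3 : (\dim (l + m) <= 3)%N.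
  by apply: leq_trans (dimvS (subvf _)) _; rewrite dimvf /dim /= mul1n.
suff gt2 : (2 < \dim (l + m))%N.
  by rewrite (_ : \dim (l + m) = 3%N) => [[]|]; last by apply/eqP; rewrite eqn_leq le3.
rewrite ltnNge; apply: contra lm => le2.
have lE : l = (l + m)%VS by apply/eqP; rewrite eqEdim addvSl l2.
have mE : m = (l + m)%VS by apply/eqP; rewrite eqEdim addvSr m2.
by rewrite lE {2}mE.
Qed.

Lemma pentagramP v w : pentagram v = Some w ->
  forall i, val (w i) = (diagonal v i :&: diagonal v (ordS i))%VS.
Proof.
rewrite /pentagram; case: ifP => // /forallP vP [<-] i.
have [/andP[vi li] /andP[vSi _]] := (vP i, vP (ordS i)).
by rewrite ffunE val_insubd dim_meet ?eqxx // dim_proj_line.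
Qed.

End Pentagram.

Section AxisAligned.
Variables (R : realType) (n : nat).

Lemma half_ord_subproof (j : 'I_n.*2) : (j./2 < n)%N.
Proof. by rewrite ltn_half_double. Qed.

Definition half_ord (j : 'I_n.*2) : 'I_n := Ordinal (half_ord_subproof j).

(* Vertex j is P_(2j+1): (a_1, b_1), (a_2, b_1), (a_2, b_2), (a_3, b_2), ...,
   (a_n, b_n), (a_1, b_n), where a_(k+1) and b_(k+1) are [a 0 k] and [b 0 k]. *)
Definition axis_aligned_polygon (a b : 'rV[R]_n) : {ffun 'I_n.*2 -> 'rV[R]_2} :=
  [ffun j : 'I_n.*2 =>
    \row_(k < 2) if k == 0
                 then a 0 (if odd j then ordS (half_ord j) else half_ord j)
                 else b 0 (half_ord j)].

(* The edges are P_j P_(j+1) for every j, starting with a horizontal one. *)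
Definition axis_aligned (P : {ffun 'I_n.*2 -> 'rV[R]_2}) : Prop :=
  forall j : 'I_n.*2, if odd j then P j 0 0 = P (ordS j) 0 0
            else P j 0 1 = P (ordS j) 0 1.

Lemma axis_aligned_polygonE a b (j : 'I_n.*2) :
  (axis_aligned_polygon a b j 0 0
     = a 0 (if odd j then ordS (half_ord j) else half_ord j)) *
  (axis_aligned_polygon a b j 0 1 = b 0 (half_ord j)).
Proof.
by rewrite ffunE !mxE.
Qed.

Lemma half_ordS (j : 'I_n.*2) :
  half_ord (ordS j) = if odd j then ordS (half_ord j) else half_ord j.
Proof.
have aux m : ((m.*2) %% n.*2)./2 = (m %% n)%N.
  by rewrite -!muln2 -muln_modl muln2 doubleK.
have jE := odd_double_half j; apply: val_inj; case: ifPn => oj /=.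
  rewrite oj in jE; rewrite -[in LHS]jE add1n -doubleS.
  by rewrite aux.
rewrite modn_small; first by rewrite /= uphalf_half (negPf oj).
by rewrite -jE (negPf oj) add0n ltn_Sdouble ltn_half_double.
Qed.

Lemma odd_ordS (j : 'I_n.*2) : odd (ordS j) = ~~ odd j.
Proof. by rewrite /= -(odd_mod _ (odd_double n)) modn_mod odd_mod ?odd_double. Qed.

Lemma axis_alignedP (P : {ffun 'I_n.*2 -> 'rV[R]_2}) :
  axis_aligned P <-> exists a b, P = axis_aligned_polygon a b.
Proof.
split=> [Pa|[a [b ->]] j]; last first.
  by rewrite !axis_aligned_polygonE half_ordS odd_ordS; case: (odd j).
have lt2 (k : 'I_n) : (k.*2 < n.*2)%N by rewrite ltn_double.
pose dbl k := Ordinal (lt2 k).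
have half_dbl k : half_ord (dbl k) = k by apply: val_inj; rewrite /= doubleK.
have dblE (j : 'I_n.*2) : ~~ odd j -> dbl (half_ord j) = j.
  by move=> /negPf oj; apply: val_inj; rewrite /= -[RHS]odd_double_half oj.
exists (\row_k P (dbl k) 0 0), (\row_k P (dbl k) 0 1).
have H (j : 'I_n.*2) : P j 0 0 = P (dbl (if odd j then ordS (half_ord j) else half_ord j)) 0 0
        /\ P j 0 1 = P (dbl (half_ord j)) 0 1.
  have [oj|oj] := boolP (odd j); last by rewrite dblE.
  have := Pa j; rewrite oj => ->; have := half_ordS j; rewrite oj => <-.
  rewrite dblE ?odd_ordS ?oj //; split=> //.
  have := Pa (dbl (half_ord j)); rewrite /= odd_double => ->.
  congr (P _ 0 1); apply: val_inj; rewrite /= modn_small.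
    by rewrite -[LHS]odd_double_half oj.
  by rewrite -[X in (X < _)%N]/(true + j./2.*2)%N -oj odd_double_half.
apply/ffunP=> j; apply/rowP=> i; have [H0 H1] := H j.
have := axis_aligned_polygonE (\row_k P (dbl k) 0 0) (\row_k P (dbl k) 0 1) j.
rewrite !mxE -H0 -H1 => -[E0 E1].
by case: i => -[|[|//]] i; [rewrite (_ : Ordinal i = 0)|rewrite (_ : Ordinal i = 1)];
  rewrite ?E0 ?E1 //; apply: val_inj.
Qed.

Definition center_of_mass (P : {ffun 'I_n.*2 -> 'rV[R]_2}) : 'rV[R]_2 :=
  (n.*2)%:R^-1 *: \sum_j P j.

End AxisAligned.

Definition to_proj (R : realType) (N : nat) (P : {ffun 'I_N -> 'rV[R]_2}) :
    {ffun 'I_N -> proj_point R} :=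
  [ffun j => affine_point (P j)].

(* Main.v *)
(* Interleave the coordinates in one function [g] of period [2n],
   [g (2m) = a_(m+1)] and [g (2m+1) = b_(m+1)].  With [E s = g (s+2) - g s],
   consecutive vertices satisfy [P_(s+1) = P_s + E s * dir s], where [dir]
   alternates between the two axis directions.

   If [c] spans the kernel of the [k x (k+1)] matrix [E (s + j + 2m)]
   ([j < k], [m <= k]), then [\sum_m c m *: P_(s + j + 2m)] is the same vector of
   R^3 for all [j <= k].  This vector is a lift of the vertex [s] of [T^k(P)]:
   killing the last or the first entry of a vector of the next kernel shows that
   the lift at step [k+1] lies on the line through the lifts [s], [s+2] at step
   [k] and on the one through [s+1], [s+3].  All nondegeneracy conditions follow
   from the invertibility of the [k x k] matrices [E (s + j + 2m)] for [k < n].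
   As the edges of either direction sum to 0, for [k = n-1] the kernel is
   spanned by the all-ones vector, which gives the center of mass. *)
Require Import Defs.
From mathcomp Require Import all_boot all_order all_algebra.
From mathcomp Require Import reals.
From mathcomp Require Import mpoly ring zify.

Set Implicit Arguments.
Unset Strict Implicit.
Unset Printing Implicit Defensive.

Import Order.TTheory GRing.Theory Num.Theory.
Local Open Scope ring_scope.

(** The entry type is arbitrary because edges are field elements at first and polynomials in the
    coordinates later. *)
Definition edge_mx (A : Type) (E : nat -> A) k s : 'M[A]_k :=
  \matrix_(j, m) E (s + j + m.*2)%N.

(** * Kernels of the edge matrices *)

Section Kernel.
Variables (F : fieldType) (E : nat -> F).
Local Notation edge_mx := (edge_mx E).

(* The kernel vector normalized by [kernel_coef k s k = 1]. *)
Definition kernel_coef k s (m : nat) : F :=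
  if insub m is Some i
  then - (invmx (edge_mx k s) *m \col_j E (s + j + k.*2)) i 0
  else (m == k)%:R.

Lemma kernel_coef_last k s : kernel_coef k s k = 1.
Proof. by rewrite /kernel_coef insubN ?ltnn // eqxx. Qed.

Lemma kernel_coef_orth k s j : edge_mx k s \in unitmx -> (j < k)%N ->
  \sum_(m < k.+1) kernel_coef k s m * E (s + j + m.*2) = 0.
Proof.
move=> Mu jk; rewrite big_ord_recr /= kernel_coef_last mul1r.
have := congr1 (fun A : 'M_(k, 1) => A (Ordinal jk) 0)
  (mulKVmx Mu (\col_j E (s + j + k.*2))).
rewrite /mulKVmx !mxE /= => <-; rewrite -big_split /= big1 // => i _.
by rewrite /kernel_coef valK [edge_mx k s _ _]mxE /=; ring.
Qed.

Lemma edge_mx_inj k s (u : nat -> F) : edge_mx k s \in unitmx ->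
  (forall j, (j < k)%N -> \sum_(m < k) u m * E (s + j + m.*2) = 0) ->
  forall m, (m < k)%N -> u m = 0.
Proof.
move=> Mu u0 m mk.
pose U : 'cV[F]_k := \col_i u i.
have : edge_mx k s *m U = 0.
  apply/colP=> j; rewrite !mxE -[RHS](u0 j) //.
  by apply: eq_bigr => i _; rewrite !mxE mulrC.
move/(congr1 (mulmx (invmx (edge_mx k s)))); rewrite mulKmx // mulmx0.
by move=> /colP/(_ (Ordinal mk)); rewrite !mxE.
Qed.

(** The difference of the two sides has last entry 0, so its other entries are killed by an
    invertible square matrix. *)
Lemma kernel_coef_unique k s (u : nat -> F) : edge_mx k s \in unitmx ->
  (forall j, (j < k)%N -> \sum_(m < k.+1) u m * E (s + j + m.*2) = 0) ->
  forall m, (m <= k)%N -> u m = u k * kernel_coef k s m.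
Proof.
move=> Mu u0 m; rewrite leq_eqVlt => /predU1P[->|mk].
  by rewrite kernel_coef_last mulr1.
apply/eqP; rewrite -subr_eq0; apply/eqP.
apply: (edge_mx_inj (u := fun m => u m - u k * kernel_coef k s m) Mu) mk.
move=> j jk.
have := u0 j jk; have := kernel_coef_orth Mu jk.
rewrite !big_ord_recr /= kernel_coef_last mul1r => /eqP; rewrite addr_eq0 => /eqP c0.
move=> /eqP; rewrite addr_eq0 => /eqP u0'.
under eq_bigr do rewrite mulrBl -mulrA.
by rewrite sumrB -mulr_sumr c0 u0'; ring.
Qed.

(** Dropping the first column shifts [s] by 2: if the first entry were 0, the others would be killed
    by [edge_mx k s.+2], although the last one is 1. *)
Lemma kernel_coef_first k s : edge_mx k s \in unitmx ->
  edge_mx k s.+2 \in unitmx -> kernel_coef k s 0 != 0.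
Proof.
move=> Mu Mu2; apply/eqP => c0.
case: k Mu Mu2 c0 => [|k] Mu Mu2 c0.
  by move: (oner_neq0 F); rewrite -c0 kernel_coef_last eqxx.
have := oner_neq0 F; rewrite -(kernel_coef_last k.+1 s) => /eqP; apply.
apply: (edge_mx_inj (u := fun m => kernel_coef k.+1 s m.+1) Mu2) (ltnSn k) => j jk.
rewrite -[RHS](kernel_coef_orth Mu jk) [RHS]big_ord_recl c0 mul0r add0r.
by apply: eq_bigr => i _; rewrite lift0 doubleS !addSn !addnS.
Qed.

(* Subtracting the shifted vector leaves a vector with last entry 0 which is
   killed by the rows [d, ..., d + k - 1]. *)
Lemma kernel_coef_step k s d : (d <= 1)%N ->
  edge_mx k (s + d) \in unitmx -> edge_mx k (s + d).+2 \in unitmx ->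
  edge_mx k.+1 s \in unitmx -> edge_mx k.+1 s.+2 \in unitmx ->
  exists2 b, b != 0 & forall m, (m <= k.+1)%N ->
    kernel_coef k.+1 s m
      = (if m is m'.+1 then kernel_coef k (s + d).+2 m' else 0)
        + b * (if (m <= k)%N then kernel_coef k (s + d) m else 0).
Proof.
move=> d1 Mu Mu2 Mu' Mu2'.
pose sh m := if m is m'.+1 then kernel_coef k (s + d).+2 m' else 0.
pose u m := kernel_coef k.+1 s m - sh m.
have uk : u k.+1 = 0 by rewrite /u /sh !kernel_coef_last subrr.
have u0 j : (j < k)%N -> \sum_(m < k.+1) u m * E (s + d + j + m.*2) = 0.
  move=> jk.
  have e0 : \sum_(m < k.+2) u m * E (s + d + j + m.*2) = 0.
    have djk : (d + j < k.+1)%N by lia.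
    under eq_bigr do rewrite mulrBl.
    rewrite sumrB; under eq_bigr do rewrite -(addnA s d j).
    rewrite kernel_coef_orth // big_ord_recl /= mul0r !add0r.
    apply/eqP; rewrite oppr_eq0; apply/eqP.
    rewrite -[RHS](kernel_coef_orth Mu2 jk); apply: eq_bigr => i _.
    by rewrite /bump leq0n doubleS !addSn !addnS.
  by move: e0; rewrite big_ord_recr /= uk mul0r addr0.
have uE := kernel_coef_unique Mu u0.
exists (u k) => [|m].
  apply/eqP => uk0; have := uE 0%N (leq0n k); rewrite uk0 mul0r /u subr0.
  by apply/eqP; apply: kernel_coef_first.
rewrite leq_eqVlt => /predU1P[->|mk].
  by rewrite ltnn mulr0 addr0 !kernel_coef_last.
by rewrite -ltnS mk -uE // /u addrC subrK.
Qed.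

(** A common kernel vector would be killed by the rows [s] to [s + k] and, from the second system,
    by row [s + k.+1]; then [edge_mx k.+2 s] forces its last entry 1 to vanish. *)
Lemma kernel_coef_neq k s : edge_mx k.+1 s \in unitmx ->
  edge_mx k.+1 s.+1 \in unitmx -> edge_mx k.+2 s \in unitmx ->
  ~ (forall m, (m <= k.+1)%N -> kernel_coef k.+1 s m = kernel_coef k.+1 s.+1 m).
Proof.
move=> Mu Mu1 Mu2 eqc; have := oner_neq0 F; rewrite -(kernel_coef_last k.+1 s).
move=> /eqP; apply; apply: (edge_mx_inj Mu2) (ltnSn k.+1) => j.
rewrite ltnS leq_eqVlt => /predU1P[->|jk]; last exact: kernel_coef_orth.
rewrite -[RHS](kernel_coef_orth Mu1 (ltnSn k)); apply: eq_bigr => i _.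
by rewrite eqc ?leq_ord // addSnnS.
Qed.

End Kernel.

(** * Lifts of the iterated vertices *)

Section Lift.
Variables (F : fieldType) (L : lmodType F) (E : nat -> F) (P dir : nat -> L).
Hypothesis P_step : forall s, P s.+1 = P s + E s *: dir s.
Hypothesis dir_period : forall s, dir s.+2 = dir s.

Definition vertex_lift k s : L := \sum_(m < k.+1) kernel_coef E k s m *: P (s + m.*2).

Lemma vertex_lift0 s : vertex_lift 0 s = P s.
Proof. by rewrite /vertex_lift big_ord1 kernel_coef_last scale1r addn0. Qed.

(** All points involved move along the same [dir s], and the weighted sum of the moves is row 0 of
    the kernel equations. *)
Lemma vertex_lift_shift k s : edge_mx E k.+1 s \in unitmx ->
  vertex_lift k.+1 s = \sum_(m < k.+2) kernel_coef E k.+1 s m *: P (s.+1 + m.*2).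
Proof.
move=> Mu; apply/eqP; rewrite eq_sym -subr_eq0 -sumrB.
have dirE m : dir (s + m.*2) = dir s.
  by elim: m => [|m <-]; rewrite ?addn0 // doubleS !addnS dir_period.
under eq_bigr do rewrite addSn P_step scalerDr addrAC subrr add0r scalerA dirE.
rewrite -scaler_suml.
by have := kernel_coef_orth Mu (ltn0Sn k); rewrite addn0 => ->; rewrite scale0r.
Qed.

(** For [d = 1] the base points are first moved by [vertex_lift_shift]. The coefficient identity is
    exported too, because two scalars [b] are later compared through it. *)
Lemma vertex_lift_step k s d : (d <= 1)%N ->
  edge_mx E k (s + d) \in unitmx -> edge_mx E k (s + d).+2 \in unitmx ->
  edge_mx E k.+1 s \in unitmx -> edge_mx E k.+1 s.+2 \in unitmx ->
  exists b, (forall m, (m <= k.+1)%N ->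
    kernel_coef E k.+1 s m
      = (if m is m'.+1 then kernel_coef E k (s + d).+2 m' else 0)
        + b * (if (m <= k)%N then kernel_coef E k (s + d) m else 0))
    /\ vertex_lift k.+1 s = vertex_lift k (s + d).+2 + b *: vertex_lift k (s + d).
Proof.
move=> d1 Mu Mu2 Mu' Mu2'.
have [b b0 bE] := kernel_coef_step d1 Mu Mu2 Mu' Mu2'.
exists b; split=> //.
have -> : vertex_lift k.+1 s
    = \sum_(m < k.+2) kernel_coef E k.+1 s m *: P (s + d + m.*2).
  by case: d d1 {Mu Mu2 b0 bE} => [|[|//]] _; rewrite ?addn0 // addn1 vertex_lift_shift.
under eq_bigr => m _ do rewrite bE ?leq_ord // scalerDl.
rewrite big_split /=; congr (_ + _).
  rewrite big_ord_recl scale0r add0r; apply: eq_bigr => i _.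
  by rewrite lift0 doubleS !addSn !addnS.
rewrite big_ord_recr /= ltnn mulr0 scale0r addr0 scaler_sumr.
by apply: eq_bigr => i _; rewrite leq_ord scalerA.
Qed.

End Lift.

(** * Vectors representing points and lines, and one step of the map *)

Section Projective.
Variable R : realType.

Definition det3 (u v w : 'rV[R]_3) : R :=
  u 0 0 * (v 0 1 * w 0 2 - v 0 2 * w 0 1)
  - u 0 1 * (v 0 0 * w 0 2 - v 0 2 * w 0 0)
  + u 0 2 * (v 0 0 * w 0 1 - v 0 1 * w 0 0).

(** The vector [x] lies on the line of [u], [w] and on that of [v], [z]; the outer arguments are
    further points of these lines. This is the induction step for the independence of consecutive
    lifts. *)
Lemma det3_cross u v w z x b b' c d : x = w + b *: u -> x = z + b' *: v ->
  det3 (w + c *: u) x (z + d *: v) = (b - c) * (d - b') * det3 u v w.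
Proof.
move=> xE xE'; have -> : z = w + b *: u - b' *: v by rewrite -xE xE' addrK.
by rewrite xE /det3 !mxE; ring.
Qed.

Lemma det3_notin u v w : det3 u v w != 0 -> v \notin (<[u]> + <[w]>)%VS.
Proof.
apply: contra => /memv_addP[_ /vlineP[a ->] [_ /vlineP[b ->] ->]].
by rewrite /det3 !mxE; apply/eqP; ring.
Qed.

Lemma det3_combination u v w b : det3 u v w != 0 -> w + b *: u != 0.
Proof.
apply: contra => /eqP; move/(canRL (addrK _)) => ->.
by rewrite /det3 !mxE; apply/eqP; ring.
Qed.

Lemma det3_line_neq u v w : det3 u v w != 0 -> (<[u]> != <[w]>)%VS.
Proof.
apply: contra => /eqP uw; have: u \in <[w]>%VS by rewrite -uw memv_line.
by move=> /vlineP[a ->]; rewrite /det3 !mxE; apply/eqP; ring.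
Qed.

Lemma vline_scale (v : 'rV[R]_3) a : a != 0 -> (<[a *: v]> = <[v]>)%VS.
Proof.
move=> a0; apply/eqP; rewrite eqEdim -memvE memvZ ?memv_line //=.
by rewrite !dim_vline scaler_eq0 (negPf a0).
Qed.

Lemma periodic_mod (T : Type) (X : nat -> T) N s :
  (forall s, X (s + N)%N = X s) -> X (s %% N)%N = X s.
Proof.
move=> XN; rewrite [in RHS](divn_eq s N) addnC.
by elim: (s %/ N)%N => [|q IHq]; rewrite ?addn0 // mulSnr addnA XN.
Qed.

(** Transfers one application of the map to vectors: [X' s] lies on two consecutive diagonals, and
    the determinants make these distinct and [X' s] nonzero. *)
Lemma pentagram_line N (v : {ffun 'I_N -> proj_point R})
    (X X' : nat -> 'rV[R]_3) :
  (forall s, X (s + N)%N = X s) ->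
  (forall s, det3 (X s) (X s.+1) (X s.+2) != 0) ->
  (forall s, exists b, X' s = X s.+2 + b *: X s) ->
  (forall s, exists b, X' s = X s.+3 + b *: X s.+1) ->
  (forall i, val (v i) = <[X i]>%VS) ->
  exists2 v', pentagram v = Some v' & forall i, val (v' i) = <[X' i]>%VS.
Proof.
move=> XN Xdet X'0 X'1 vE.
have vSE i : val (v (ordS i)) = <[X i.+1]>%VS by rewrite vE /= periodic_mod.
have vSSE i : val (v (ordS (ordS i))) = <[X i.+2]>%VS.
  rewrite (vSE (ordS i)) /=; congr <[_]>%VS.
  by rewrite (periodic_mod (X := fun s => X s.+1)) // => s; rewrite -addSn XN.
have vSSSE i : val (v (ordS (ordS (ordS i)))) = <[X i.+3]>%VS.
  rewrite (vSSE (ordS i)) /=; congr <[_]>%VS.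
  by rewrite (periodic_mod (X := fun s => X s.+2)) // => s; rewrite -!addSn XN.
have vP : pentagram_defined v.
  apply/forallP=> i; rewrite -val_eqE (vE i) vSSE (det3_line_neq (Xdet i)) /=.
  rewrite /diagonal /proj_line vE (vSE i) vSSE vSSSE.
  (* The vector [X i.+1] lies on the second diagonal but not on the first. *)
  apply: contra (det3_notin (Xdet i)) => /eqP ->.
  by apply: (subvP (addvSl _ _)); exact: memv_line.
have [v' vv'] : exists v', pentagram v = Some v'.
  by rewrite /pentagram vP; eexists.
exists v' => // i; rewrite (pentagramP vv').
have [b bE] := X'0 i; have [b' b'E] := X'1 i.
have X'n0 : X' i != 0 by rewrite bE (det3_combination _ (Xdet i)).
(* The intersection is the point [v' i], hence of dimension 1, so containing the nonzero [X' i]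
   suffices. *)
apply/esym/eqP; rewrite eqEdim -memvE memv_cap.
rewrite -(pentagramP vv') (eqP (svalP (v' i))) dim_vline X'n0 andbT.
rewrite /diagonal /proj_line vE (vSE i) vSSE vSSSE {1}bE b'E.
by apply/andP; split; rewrite addrC memv_add ?memvZ ?memv_line.
Qed.

Lemma homogeneousE (u : 'rV[R]_2) : (homogeneous u 0 0 = u 0 0) *
  (homogeneous u 0 1 = u 0 1) * (homogeneous u 0 2 = 1).
Proof.
rewrite (_ : 2 = rshift 2 (0 : 'I_1)) ?(row_mxEr u); last exact: val_inj.
rewrite (_ : 1 = lshift 1 (1 : 'I_2)) ?(row_mxEl u); last exact: val_inj.
rewrite (_ : 0 = lshift 1 (0 : 'I_2)) ?(row_mxEl u); last exact: val_inj.
by rewrite mxE eqxx.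
Qed.

Lemma row3P (u v : 'rV[R]_3) :
  u 0 0 = v 0 0 -> u 0 1 = v 0 1 -> u 0 2 = v 0 2 -> u = v.
Proof.
move=> u0 u1 u2; apply/rowP=> -[[|[|[|//]]] i].
- by rewrite (_ : Ordinal i = 0) //; apply: val_inj.
- by rewrite (_ : Ordinal i = 1) //; apply: val_inj.
- by rewrite (_ : Ordinal i = 2) //; apply: val_inj.
Qed.

(** The third coordinate counts the summands, so a sum of lifts represents the centroid. *)
Lemma homogeneous_sum N (u : 'I_N -> 'rV[R]_2) : (0 < N)%N ->
  \sum_i homogeneous (u i) = N%:R *: homogeneous (N%:R^-1 *: \sum_i u i).
Proof.
move=> N0; have Nn0 : N%:R != 0 :> R by rewrite pnatr_eq0 -lt0n.
apply: row3P; rewrite summxE [RHS]mxE homogeneousE;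
  under eq_bigr do rewrite homogeneousE.
- by rewrite mxE summxE mulVKf.
- by rewrite mxE summxE mulVKf.
by rewrite sumr_const card_ord mulr1.
Qed.

End Projective.

(** * The polygon of a periodic sequence and its collapse *)

Section Polygon.
Variables (R : realType) (n : nat) (g : nat -> R).
Hypothesis g_period : forall s, g (s + n.*2)%N = g s.

Let E s := g s.+2 - g s.

Hypothesis E_generic : forall k s, (k < n)%N -> edge_mx E k s \in unitmx.

(* The two coordinates are [g s] and [g s.+1], the even argument coming first. *)
Definition vertex s : 'rV[R]_2 :=
  \row_(k < 2) g (if k == 0 then (uphalf s).*2 else (s./2).*2.+1).

Let P s := homogeneous (vertex s).
(** The boolean [odd s] is read as the index of the coordinate that changes along edge [s]. *)
Let dir s : 'rV[R]_3 := \row_(k < 3) (k == odd s :> nat)%:R.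

Let P_step s : P s.+1 = P s + E s *: dir s.
Proof.
have rE k : (P s + E s *: dir s) 0 k = P s 0 k + E s * (k == odd s :> nat)%:R.
  by rewrite mxE [X in _ + X]mxE [dir s _ _]mxE.
apply: row3P; rewrite rE !homogeneousE ?mxE /= /E.
- have [os|es] := boolP (odd s); rewrite ?mulr0 ?addr0 ?mulr1.
    by rewrite uphalf_half os add1n.
  rewrite [X in _ = g X + _](_ : _ = s) 1?addrC ?subrK; last lia.
  by congr g; lia.
- have [os|es] := boolP (odd s); rewrite ?mulr0 ?addr0 ?mulr1.
    by rewrite [X in _ = g X + _](_ : _ = s) 1?addrC ?subrK; [congr g|]; lia.
  by congr g; lia.
by case: (odd s); rewrite mulr0 addr0.
Qed.
Let dir_period s : dir s.+2 = dir s.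
Proof. by apply/rowP=> i; rewrite !mxE /= negbK. Qed.

Let V k s := vertex_lift E P k s.

Let V_step k s d : (k.+1 < n)%N -> (d <= 1)%N -> exists b,
   (forall m, (m <= k.+1)%N ->
    kernel_coef E k.+1 s m
      = (if m is m'.+1 then kernel_coef E k (s + d).+2 m' else 0)
        + b * (if (m <= k)%N then kernel_coef E k (s + d) m else 0))
    /\ V k.+1 s = V k (s + d).+2 + b *: V k (s + d).
Proof.
move=> kn d1; have kn' := ltnW kn.
by apply: (vertex_lift_step P_step dir_period); rewrite ?E_generic.
Qed.

(** Induction on [k]: initially the determinant is, up to sign, a product of two consecutive edges;
    afterwards [det3_cross] leaves two differences of scalars to be shown nonzero. *)
Let V_det k s : (k.+1 < n)%N -> det3 (V k s) (V k s.+1) (V k s.+2) != 0.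
Proof.
elim: k s => [|k IHk] s kn.
  have E0 t : E t != 0.
    have := E_generic t kn; rewrite unitmxE [edge_mx _ _ _]mx11_scalar.
    by rewrite det_scalar1 mxE !addn0 unitfE.
  rewrite /V !vertex_lift0 !P_step.
  rewrite (_ : det3 _ _ _ = (-1) ^+ odd s * E s * E s.+1).
    by rewrite !mulf_neq0 // signr_eq0.
  have Pz : P s 0 2 = 1 by rewrite homogeneousE.
  move: (P s) Pz => p pz; rewrite /det3 !mxE pz /=.
  by case: (odd s) => /=; rewrite ?expr0 ?expr1; ring.
have kn' := ltnW kn.
have [c [cE ->]] := V_step s kn' (leqnn 1).
have [b [bE xE]] := V_step s.+1 kn' (leq0n 1).
have [b' [b'E xE']] := V_step s.+1 kn' (leqnn 1).
have [d [dE ->]] := V_step s.+2 kn' (leq0n 1).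
rewrite !addn0 !addn1 in xE xE' cE bE b'E dE *.
rewrite (det3_cross _ _ xE xE') !mulf_neq0 ?IHk // subr_eq0; apply/eqP=> bc.
  (* Equal scalars would make neighbouring kernel vectors agree, as both are combinations of the
     same two vectors of the previous step. *)
  apply: (@kernel_coef_neq _ E k s); rewrite ?E_generic // => m mk.
  by rewrite cE // bE // bc.
apply: (@kernel_coef_neq _ E k s.+1); rewrite ?E_generic // => m mk.
by rewrite b'E // dE // bc.
Qed.

Let E_period s : E (s + n.*2) = E s.
Proof. by rewrite /E -!addSn !g_period. Qed.

Let vertex_period s : vertex (s + n.*2)%N = vertex s.
Proof.
apply/rowP=> i; rewrite !mxE; case: ifP => _; rewrite -[RHS]g_period.
  by congr g; lia.
by congr g; lia.
Qed.

Let V_period k s : V k (s + n.*2) = V k s.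
Proof.
have ME : edge_mx E k (s + n.*2) = edge_mx E k s.
  by apply/matrixP=> i j; rewrite !mxE -!addnA [(n.*2 + _)%N]addnC !addnA E_period.
apply: eq_bigr => m _; rewrite addnAC /P vertex_period; congr (_ *: _).
rewrite /kernel_coef ME; case: insubP => // i _ _; congr (- (_ *m _) _ _).
by apply/colP=> j; rewrite !mxE -!addnA [(n.*2 + _)%N]addnC !addnA E_period.
Qed.

Let iterE k (v : {ffun 'I_n.*2 -> proj_point R}) : (k < n)%N ->
  (forall i, val (v i) = <[P i]>%VS) ->
  exists2 w, pentagram_iter k v = Some w & forall i, val (w i) = <[V k i]>%VS.
Proof.
move=> kn vE; elim: k kn => [_|k IHk kn].
  by exists v => // i; rewrite /V vertex_lift0.
have [w wE wV] := IHk (ltnW kn).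
have [|||w' w'E w'V] := @pentagram_line R _ w (V k) (V k.+1) (V_period k) _ _ _ wV.
- by move=> s; exact: V_det.
- by move=> s; have [b [_ bE]] := V_step s kn (leq0n 1); exists b; rewrite bE addn0.
- by move=> s; have [b [_ bE]] := V_step s kn (leqnn 1); exists b; rewrite bE addn1.
by exists w' => //; rewrite /pentagram_iter iterS -/(pentagram_iter k v) wE.
Qed.

(** The edges telescope over a period of [g], so the constant vector 1 solves the kernel
    equations. *)
Let kernel_coef1 s m : (0 < n)%N -> (m < n)%N -> kernel_coef E n.-1 s m = 1.
Proof.
move=> n0 mn; have n1 : (n.-1 < n)%N by rewrite ltn_predL.
rewrite -[LHS]mul1r.
apply/esym/(kernel_coef_unique (u := fun=> 1) (E_generic s n1)); last first.
  by rewrite -ltnS prednK.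
move=> j _; under eq_bigr do rewrite mul1r /E -!addnS -!doubleS.
rewrite prednK //.
rewrite -(big_mkord xpredT (fun m => g (s + j + m.+1.*2) - g (s + j + m.*2))).
by rewrite telescope_sumr // g_period addn0 subrr.
Qed.

Lemma pentagram_collapse (v : {ffun 'I_n.*2 -> proj_point R}) : (1 < n)%N ->
  (forall i, val (v i) = <[homogeneous (vertex i)]>%VS) ->
  pentagram_iter n.-1 v
    = Some [ffun => affine_point (n.*2%:R^-1 *: \sum_(j < n.*2) vertex j)].
Proof.
move=> n_gt1 vE; have n0 := ltnW n_gt1; have n1 : (n.-1 < n)%N by rewrite ltn_predL.
have [w -> wE] := iterE n1 vE; congr Some; apply/ffunP=> i.
have VE s : V n.-1 s = \sum_(m < n) P (s + m.*2).
  rewrite /V /vertex_lift prednK //.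
  by apply: eq_bigr => m _; rewrite kernel_coef1 ?scale1r.
(* With all weights 1, [vertex_lift_shift] equates the sums over the two parities of vertices; it
   needs at least one kernel equation, hence [n.-1 = k.+1]. *)
have VS s : V n.-1 s.+1 = V n.-1 s.
  have [k kE] : exists k, n.-1 = k.+1 by exists n.-2; rewrite prednK // -ltnS prednK.
  have Mu := E_generic s n1; rewrite [LHS]VE /V.
  move: kernel_coef1; rewrite kE in Mu * => one.
  rewrite (vertex_lift_shift P_step dir_period Mu) -kE prednK //.
  by apply: eq_bigr => m _; rewrite kE one ?scale1r.
have VC s : V n.-1 s = V n.-1 0 by elim: s => // s IHs; rewrite VS.
(* The vertices of each parity contribute one copy of the common lift. *)
have sumP : \sum_(j < n.*2) P j = 2%:R *: V n.-1 0.
  rewrite scaler_nat mulr2n -{2}(VS 0%N) !VE.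
  rewrite -(big_mkord xpredT P) -(big_mkord xpredT (fun m => P (0 + m.*2)%N)).
  rewrite -(big_mkord xpredT (fun m => P (1 + m.*2)%N)).
  elim: (n) => [|m IHm]; first by rewrite !big_geq ?addr0.
  rewrite doubleS !big_nat_recr //= IHm; rewrite !add0n add1n.
  by rewrite -!addrA; congr (_ + _); rewrite !addrA; congr (_ + _); rewrite addrC.
apply: val_inj; rewrite ffunE wE VC /=.
have -> : V n.-1 0 = 2%:R^-1 *: \sum_(j < n.*2) P j.
  by rewrite sumP scalerA mulVf ?pnatr_eq0 // scale1r.
rewrite homogeneous_sum ?double_gt0 // scalerA vline_scale //.
by rewrite mulf_neq0 ?invr_neq0 // pnatr_eq0 // -lt0n double_gt0.
Qed.

End Polygon.

(** * Common nonroots of finitely many polynomials *)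

Section NonVanishing.
Variables (F : numFieldType).

(** The naturals below [size p] are distinct in characteristic 0, and too many to be all roots. *)
Lemma poly_nonroot (p : {poly F}) : p != 0 -> exists t, p.[t] != 0.
Proof.
move=> p0; pose rs := [seq i%:R : F | i <- iota 0 (size p)].
have [/allPn[t _ tP]|/negPn rP] := boolP (~~ all (root p) rs); first by exists t.
suff /(max_poly_roots p0 rP) : uniq rs by rewrite size_map size_iota ltnn.
by rewrite map_inj_uniq ?iota_uniq // => i j /eqP; rewrite eqr_nat => /eqP.
Qed.

(* Restrict both factors to the line through the two points. *)
Lemma mpoly_mul_nonroot m (p q : {mpoly F[m]}) (x y : 'rV[F]_m) :
  p.@[x 0] != 0 -> q.@[y 0] != 0 -> exists z : 'rV_m, (p * q).@[z 0] != 0.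
Proof.
move=> px qy; pose l i : {poly F} := (x 0 i)%:P + (y 0 i - x 0 i)%:P * 'X.
pose line t : 'rV_m := \row_i (l i).[t].
have lineE (r : {mpoly F[m]}) t : (mmap polyC l r).[t] = r.@[line t 0].
  rewrite /mmap mevalE horner_sum; apply: eq_bigr => u _.
  rewrite hornerM hornerC /mmap1 horner_prod; congr (_ * _).
  by apply: eq_bigr => i _; rewrite horner_exp mxE.
have line0 : line 0 = x by apply/rowP=> i; rewrite mxE !hornerE.
have line1 : line 1 = y.
  by apply/rowP=> i; rewrite mxE hornerD hornerCM hornerC hornerX mulr1 addrC subrK.
have [|t] := @poly_nonroot (mmap polyC l p * mmap polyC l q).
  rewrite mulf_neq0 //.
    by apply: contraNneq px => p0; rewrite -line0 -lineE p0 horner0.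
  by apply: contraNneq qy => q0; rewrite -line1 -lineE q0 horner0.
by rewrite hornerM !lineE -mevalM; exists (line t).
Qed.

(** Lets each determinant have its own witness, although genericity asks for a point that suits all
    of them. *)
Lemma mpoly_prod_nonroot m (I : eqType) (r : seq I) (p : I -> {mpoly F[m]}) :
  (forall i, i \in r -> exists x : 'rV_m, (p i).@[x 0] != 0) ->
  exists x : 'rV_m, (\prod_(i <- r) p i).@[x 0] != 0.
Proof.
elim: r => [|i r IHr] rP; first by exists 0; rewrite big_nil meval1 oner_eq0.
have [x px] := rP i (mem_head _ _).
have [|y py] := IHr; first by move=> j jr; apply: rP; rewrite inE jr orbT.
by rewrite big_cons; exact: mpoly_mul_nonroot px py.
Qed.

End NonVanishing.

(** * The edge determinants are nonzero polynomials *)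

Section Genericity.
Variables (F : numFieldType) (n : nat) (n_gt0 : (0 < n)%N).

(* The variable a_(m+1) for s = 2m and b_(m+1) for s = 2m+1. *)
Definition coord_index s : 'I_(n + n) :=
  let m := Ordinal (ltn_pmod s./2 n_gt0) in
  if odd s then rshift n m else lshift n m.

Lemma coord_index_period s : coord_index (s + n.*2)%N = coord_index s.
Proof.
rewrite /coord_index oddD odd_double addbF.
have E : Ordinal (ltn_pmod (s + n.*2)./2 n_gt0) = Ordinal (ltn_pmod s./2 n_gt0).
  by apply: val_inj; rewrite /= halfD odd_double andbF add0n doubleK modnDr.
by rewrite E.
Qed.

Lemma coord_index_inj s t : coord_index s = coord_index t -> s = t %[mod n.*2].
Proof.
move=> E; have [Eo Eh] : odd s = odd t /\ s./2 = t./2 %[mod n].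
  move: E; rewrite /coord_index; case: (odd s) (odd t) => -[] /(congr1 val) /=.
  - by move/addnI.
  - by have := ltn_pmod t./2 n_gt0; lia.
  - by have := ltn_pmod s./2 n_gt0; lia.
  - by [].
rewrite -[s]odd_double_half -[t]odd_double_half Eo; apply/eqP.
by rewrite eqn_modDl -!muln2 -!muln_modl Eh.
Qed.

Definition coord_edge (s : nat) : {mpoly F[n + n]} :=
  'X_(coord_index s.+2) - 'X_(coord_index s).

Definition edge_det k s : {mpoly F[n + n]} := \det (edge_mx coord_edge k s).

Lemma edge_detE (x : 'rV[F]_(n + n)) k s :
  (edge_det k s).@[x 0]
    = \det (edge_mx (fun s => x 0 (coord_index s.+2) - x 0 (coord_index s)) k s).
Proof.
rewrite -det_map_mx; congr (\det _); apply/matrixP=> i j.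
by rewrite !mxE /coord_edge [LHS]mevalB !mevalXU.
Qed.

(** Reduces the conditions for all [s] to finitely many. *)
Lemma edge_det_mod k s : edge_det k (s %% n.*2) = edge_det k s.
Proof.
apply: periodic_mod => t; congr (\det _); apply/matrixP=> i j.
rewrite !mxE (_ : (t + n.*2 + i + j.*2 = t + i + j.*2 + n.*2)%N); last lia.
by rewrite /coord_edge -!addSn !coord_index_period.
Qed.

(** The index [q = k] is allowed, which is where the descent below starts. *)
Lemma sum_indicator k (u : nat -> F) q : (forall m, (k <= m)%N -> u m = 0) ->
  \sum_(m < k) u m * (m == q :> nat)%:R = u q.
Proof.
move=> u0; have [qk|kq] := ltnP q k.
  rewrite (bigD1 (Ordinal qk)) //= eqxx mulr1 big1 ?addr0 // => m.
  by rewrite -val_eqE /= => /negPf->; rewrite mulr0.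
rewrite u0 // big1 // => m _; rewrite ltn_eqF ?mulr0 //.
exact: leq_trans (ltn_ord m) kq.
Qed.

(* With a single nonzero a- and a single nonzero b-coordinate, placed as below,
   the equations [edge_mx *m u = 0] read [u 0 = u 1 = ... = u k], where
   [u k = 0] by convention. *)
Lemma edge_det_nonroot k s : (k < n)%N ->
  exists x : 'rV[F]_(n + n), (edge_det k s).@[x 0] != 0.
Proof.
move=> kn; pose h := uphalf k.
pose x : 'rV[F]_(n + n) := \row_i
  ((i == coord_index (s + k.*2)) || (i == coord_index (s + (k - h).*2.+1)))%:R.
have idx a b : (a < b + n.*2)%N -> (b < a + n.*2)%N ->
    (coord_index (s + a) == coord_index (s + b)) = (a == b).
  move=> ab ba; apply/eqP/eqP=> [/coord_index_inj/eqP|->//].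
  rewrite eqn_modDl; have [le_ba|/ltnW le_ab] := leqP b a.
    by rewrite eqn_mod_dvd // => /dvdn_leq; lia.
  by rewrite eq_sym eqn_mod_dvd // => /dvdn_leq; lia.
(* The offsets in the matrix are at most [3 * k]; as [k < n], they differ from the two chosen ones
   by less than the period [n.*2]. *)
have xE a : (a <= 3 * k)%N -> x 0 (coord_index (s + a))
    = ((a == k.*2) || (a == (k - h).*2.+1))%:R.
  by move=> a3; rewrite mxE !idx //; lia.
exists x; rewrite edge_detE -unitfE -unitmxE -unitmx_tr -row_free_unit.
apply: inj_row_free => v v0.
pose u m := if insub m is Some i then v 0 i else 0.
have u_out m : (k <= m)%N -> u m = 0 by move=> km; rewrite /u insubN // -leqNgt.
have rowE j : (j < k)%N -> \sum_(m < k) u m *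
    (x 0 (coord_index (s + (j + m.+1.*2))) - x 0 (coord_index (s + (j + m.*2)))) = 0.
  move=> jk; move/rowP/(_ (Ordinal jk)): v0; rewrite !mxE => v0.
  rewrite -[RHS]v0; apply: eq_bigr => m _.
  rewrite [_^T _ _]mxE [edge_mx _ _ _ _ _]mxE /u valK.
  by rewrite doubleS !addnS !addnA.
(* Row [r.*2] equates [u (k - r.+1)] with [u (k - r)]; the [h] even rows descend from [u k = 0] to
   [u (k - h)]. *)
have u_hi r : (r <= h)%N -> u (k - r)%N = 0.
  elim: r => [|r IHr] rh; first by rewrite subn0 u_out.
  rewrite -(IHr (ltnW rh)) -!(sum_indicator _ u_out); apply/eqP.
  rewrite -subr_eq0 -sumrB; apply/eqP; rewrite -[RHS](rowE r.*2); last lia.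
  apply: eq_bigr => m _; have := ltn_ord m.
  move=> mk; rewrite -mulrBr !xE; [|lia|lia].
  by congr (_ * (_%:R - _%:R)); lia.
(* The [k - h] odd rows continue the descent to [u 0]. *)
have u_lo r : (r <= k - h)%N -> u (k - h - r)%N = 0.
  elim: r => [|r IHr] rh; first by rewrite subn0 u_hi.
  rewrite -(IHr (ltnW rh)) -!(sum_indicator _ u_out); apply/eqP.
  rewrite -subr_eq0 -sumrB; apply/eqP; rewrite -[RHS](rowE r.*2.+1); last lia.
  apply: eq_bigr => m _; have := ltn_ord m.
  move=> mk; rewrite -mulrBr !xE; [|lia|lia].
  by congr (_ * (_%:R - _%:R)); lia.
apply/rowP=> i; rewrite mxE; have := ltn_ord i => ik.
have -> : v 0 i = u i by rewrite /u valK.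
have [le_h|lt_h] := leqP (k - i) h.
  by rewrite -[X in u X](subKn (ltnW ik)) u_hi.
by rewrite (_ : nat_of_ord i = k - h - (k - h - i))%N ?u_lo //; lia.
Qed.

End Genericity.

Theorem theorem1p3 (R : realType) (n : nat) (n_ge2 : (2 <= n)%N) :
  generically (fun ab : 'rV[R]_(n + n) =>
    let P := axis_aligned_polygon (lsubmx ab) (rsubmx ab) in
    pentagram_iter n.-1 (to_proj P)
      = Some [ffun => affine_point (center_of_mass P)]).
Proof.
have n_gt0 := ltnW n_ge2.
pose r := [seq (k, s) | k <- iota 0 n, s <- iota 0 n.*2].
(* By periodicity in [s], the nonvanishing of this one product gives every invertibility needed. *)
pose D := \prod_(ks <- r) edge_det R n_gt0 ks.1 ks.2.
exists (fun x => D.@[x 0] != 0); split.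
- by exists (eq D) => x; split=> [Dx|[_ <-]//]; exists D.
- apply: mpoly_prod_nonroot => -[k s] /allpairsP[[k' s'] [+ _ [-> _]]] /=.
  by rewrite mem_iota => /andP[_ kn]; exact: edge_det_nonroot.
move=> x Dx P; pose g s := x 0 (coord_index n_gt0 s).
have PE (j : 'I_n.*2) : P j = vertex g j.
  apply/rowP=> i; rewrite ffunE !mxE /g /coord_index.
  case: ifP => _; rewrite /= ?odd_double ?doubleK; congr (x _ _); apply: val_inj => /=.
    case: ifP => oj /=; first by rewrite uphalf_half oj.
    by rewrite uphalf_half oj modn_small ?half_ord_subproof.
  by rewrite uphalf_double modn_small ?half_ord_subproof.
rewrite (@pentagram_collapse R n g) //.
- congr (Some _); apply/ffunP=> i; rewrite !ffunE /center_of_mass.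
  by under eq_bigr do rewrite -PE.
- by move=> s; rewrite /g coord_index_period.
- move=> k s kn; rewrite unitmxE unitfE -edge_detE -edge_det_mod.
  apply: contraNneq Dx => Dks; rewrite rmorph_prod.
  rewrite (big_rem (k, s %% n.*2)%N) /= ?Dks ?mul0r //.
  by apply: allpairs_f; rewrite mem_iota //= ltn_pmod ?double_gt0.
- by move=> i; rewrite ffunE PE.
Qed.
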